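(* Let $f\in\mathbb{R}^N$ and let $P:\mathbb{R}^N\to\mathbb{R}^N$ be a map satisfying: (1) monotonicity: for all $u,v\in\mathbb{R}^N$, $u\ge v$ implies $Pu\ge Pv$; (2) strict monotonicity of corresponding components: for all $u,v\in\mathbb{R}^N$ and every $x\in\{1,\dots,N\}$, if $u\ge v$ and $u(x)>v(x)$, then $Pu(x)>Pv(x)$; (5) non-expansion: $\|Pu-Pv\|_{\infty}\le\|u-v\|_{\infty}$ for all $u,v\in\mathbb{R}^N$; (9) finite accumulation point: the sequence $(P^nf)_{n}$ has an accumulation point $g\in\mathbb{R}^N$. Then $Pg=g$ and $P^nf\to g$ as $n\to\infty$.
   Context: Inequalities between vectors of $\mathbb{R}^N$ are componentwise: $u\ge v$ means $u(x)\ge v(x)$ for all $x=1,\dots,N$. $\|u\|_\infty=\max_x|u(x)|$. $P^n$ is the $n$-fold iterate of $P$. A vector $g\in\mathbb{R}^N$ is a finite accumulation point of a sequence $(h_n)$ in $\mathbb{R}^N$ if for every $n$ and every $\epsilon>0$ there is $k>n$ with $\|h_k-g\|_\infty<\epsilon$. (A map satisfying (1) and (5) is called a discrete-time nonlinear Markov chain.) *)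

(* Defs.v *)
From HB Require Import structures.
From mathcomp Require Import all_boot all_order all_algebra.
From mathcomp Require Import all_classical all_reals all_analysis.

Set Implicit Arguments.
Unset Strict Implicit.
Unset Printing Implicit Defensive.

Import Order.TTheory GRing.Theory Num.Theory.
Import numFieldNormedType.Exports.

Local Open Scope classical_set_scope.
Local Open Scope ring_scope.

(* The norm `|u| of u : 'rV[R]_N is the library's mx_norm, i.e. the maximum
   of the absolute values of the entries, and the topology of 'rV[R]_N is the
   one it induces. *)

Definition vec_ge (R : realType) (N : nat) (u v : 'rV[R]_N) : Prop :=
  forall x : 'I_N, v ord0 x <= u ord0 x.

Definition monotone_map (R : realType) (N : nat)
    (P : 'rV[R]_N -> 'rV[R]_N) : Prop :=
  forall u v : 'rV[R]_N, vec_ge u v -> vec_ge (P u) (P v).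

Definition strictly_monotone_components (R : realType) (N : nat)
    (P : 'rV[R]_N -> 'rV[R]_N) : Prop :=
  forall (u v : 'rV[R]_N) (x : 'I_N),
    vec_ge u v -> v ord0 x < u ord0 x -> P v ord0 x < P u ord0 x.

Definition non_expansive (R : realType) (N : nat)
    (P : 'rV[R]_N -> 'rV[R]_N) : Prop :=
  forall u v : 'rV[R]_N, `|P u - P v| <= `|u - v|.

Definition finite_accumulation_point (R : realType) (N : nat)
    (h : nat -> 'rV[R]_N) (g : 'rV[R]_N) : Prop :=
  forall (n : nat) (eps : R), 0 < eps ->
    exists k : nat, (n < k)%N /\ `|h k - g| < eps.

(* Main.v *)
(* By recurrence of g, all increments P^(n+1) g - P^n g have the same norm
   d = |P g - g|.  Strict monotonicity together with non-expansion shows that a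
   component of P u - P v can attain the bound |u - v| (with a given sign) only
   if the same component of u - v attains it with the same sign.  Hence, if
   d > 0, a component attaining d in the n-th increment attains it, with the
   same sign, in all earlier increments, so P^(n+1) g is at distance at least
   (n+1) d from g, contradicting recurrence.  Once P g = g, the distance
   |P^n f - g| is nonincreasing and has arbitrarily small values. *)
Require Import Defs.
From HB Require Import structures.
From mathcomp Require Import all_boot all_order all_algebra.
From mathcomp Require Import all_classical all_reals all_analysis.
From mathcomp Require Import lra.
Import Order.TTheory GRing.Theory Num.Theory.
Import numFieldNormedType.Exports.
Local Open Scope classical_set_scope.
Local Open Scope ring_scope.

Lemma ler_row_norm (R : realType) (N : nat) (u : 'rV[R]_N) (x : 'I_N) :
  `|u ord0 x| <= `|u|.
Proof.
rewrite [leRHS]mx_normrE.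
exact: (le_bigmax _ (fun ij => `|u ij.1 ij.2|) (ord0, x)).
Qed.

(** Only an inequality, since for [N = 0] the norm is 0 whatever [t] is. *)
Lemma row_norm_const_le (R : realType) (N : nat) (t : R) (t_ge0 : 0 <= t) :
  `|const_mx t : 'rV[R]_N| <= t.
Proof.
rewrite [leLHS]mx_normrE; apply/bigmax_leP; split=> // i _.
by rewrite mxE ger0_norm.
Qed.

Lemma row_norm_attained (R : realType) (N : nat) (u : 'rV[R]_N) :
  0 < `|u| -> exists x, `|u ord0 x| = `|u|.
Proof.
move=> u_gt0; have /mx_norm_neq0[[i x] /= ux] : mx_norm u != 0.
  exact: lt0r_neq0.
by exists x; rewrite [RHS]ux (ord1 i).
Qed.

Lemma telescope_ge (R : realType) (a : nat -> R) (d : R) (n : nat) :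
  (forall k, (k < n)%N -> d <= a k.+1 - a k) -> d *+ n <= a n - a 0%N.
Proof.
elim: n => [_|n IHn ad]; first by rewrite subrr.
have := ad n (ltnSn n); have := IHn (fun k kn => ad k (ltnW kn)).
by rewrite mulrSr; lra.
Qed.

Section Iteration.
Context (R : realType) (N : nat) (P : 'rV[R]_N -> 'rV[R]_N).
Hypothesis P_nonexp : non_expansive P.

Lemma iter_nonexp (n : nat) (u v : 'rV[R]_N) :
  `|iter n P u - iter n P v| <= `|u - v|.
Proof. by elim: n => //= n; apply: le_trans. Qed.

(** If the orbit of [f] is near [g] at times [k < l], then non-expansion keeps [P^(l-k) g] near
    [P^l f], hence near [g]. *)
Lemma accumulation_recurrent (f g : 'rV[R]_N) (n : nat) (e : R) :
  finite_accumulation_point (fun k => iter k P f) g -> 0 < e ->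
  exists2 m, (n < m)%N & `|iter m P g - g| < e.
Proof.
move=> g_acc e_gt0; have e2_gt0 : 0 < e / 2 by lra.
have [k [_ fk]] := g_acc 0%N _ e2_gt0.
(* The second visit is taken after time [n + k] so that [l - k] exceeds [n]. *)
have [l [nkl fl]] := g_acc (n + k)%N _ e2_gt0.
exists (l - k)%N; first by rewrite ltn_subRL addnC.
have kl : (k <= l)%N := leq_trans (leq_addl n k) (ltnW nkl).
have := iter_nonexp (l - k) g (iter k P f).
rewrite -iterD subnK // (distrC g).
have := ler_distD (iter l P f) (iter (l - k) P g) g.
lra.
Qed.

(** Increment norms cannot grow with time. At a return time [m] past [n], both ends of the increment
    are within [e / 2] of [g] and [P g], so its norm has lost less than [e]. *)
Lemma recurrent_increment_norm (g : 'rV[R]_N) (n : nat) :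
  (forall e, 0 < e -> exists2 m, (n < m)%N & `|iter m P g - g| < e) ->
  `|iter n P (P g) - iter n P g| = `|P g - g|.
Proof.
move=> g_rec; apply/eqP; rewrite eq_le iter_nonexp /=.
apply/ler_addgt0Pr => e e_gt0.
have e2_gt0 : 0 < e / 2 by lra.
have [m nm gm] := g_rec _ e2_gt0.
have := iter_nonexp (m - n) (iter n P (P g)) (iter n P g).
rewrite -!iterD subnK ?(ltnW nm) // -iterSr iterS.
have := P_nonexp (iter m P g) g.
have := ler_distD (P (iter m P g)) (P g) g.
have := ler_distD (iter m P g) (P (iter m P g)) g.
rewrite (distrC (P g) (P (iter m P g))).
lra.
Qed.

Hypothesis P_smono : strictly_monotone_components P.

(** Otherwise [w], the shift of [v] by the constant [t], dominates [u] strictly at [x], so that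
    [P u] at [x] is below [P w], which by non-expansion is at most [P v + t] there. *)
Lemma max_component_pullback (u v : 'rV[R]_N) (t : R) (x : 'I_N) :
  `|u - v| <= t -> t <= P u ord0 x - P v ord0 x -> t <= u ord0 x - v ord0 x.
Proof.
move=> uvt Pt; rewrite leNgt; apply/negP => uvx.
have t_ge0 : 0 <= t := le_trans (normr_ge0 _) uvt.
pose w := v + const_mx t : 'rV[R]_N.
have wu : vec_ge w u.
  move=> y; have := ler_row_norm _ _ (u - v) y.
  rewrite !mxE; have := ler_norm (u ord0 y - v ord0 y); lra.
have := P_smono w u x wu; rewrite !mxE => Pwu.
have {}Pwu : P u ord0 x < P w ord0 x by apply: Pwu; lra.
have := ler_row_norm _ _ (P w - P v) x; rewrite !mxE.
have := ler_norm (P w ord0 x - P v ord0 x).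
have := P_nonexp w v; rewrite [w - v]addrC addKr.
have := row_norm_const_le R N t t_ge0.
lra.
Qed.

Lemma max_component_pullback_iter (u v : 'rV[R]_N) (t : R) (x : 'I_N)
    (n k : nat) :
  `|u - v| <= t -> t <= iter n P u ord0 x - iter n P v ord0 x ->
  (k <= n)%N -> t <= iter k P u ord0 x - iter k P v ord0 x.
Proof.
move=> uvt; elim: n => [|n IHn] tn; first by rewrite leqn0 => /eqP ->.
rewrite leq_eqVlt => /predU1P[-> //|]; apply: IHn.
by apply: max_component_pullback tn; apply: le_trans (iter_nonexp n u v) _.
Qed.

Lemma recurrent_fixed (g : 'rV[R]_N) :
  (forall n e, 0 < e -> exists2 m, (n < m)%N & `|iter m P g - g| < e) ->
  P g = g.
Proof.
move=> g_rec; apply/eqP; rewrite -subr_eq0 -normr_eq0; apply/negPn/negP => dn0.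
set d := `|P g - g| in dn0.
have d_gt0 : 0 < d by rewrite lt0r dn0 normr_ge0.
(* A return to within [d] of [g] at a positive time [n.+1]; the [n]-th increment is the last one
   before it. *)
have [[//|n] _ gn] := g_rec 0%N d d_gt0.
have dn : `|iter n P (P g) - iter n P g| = d.
  exact/recurrent_increment_norm/g_rec.
have [|x] := row_norm_attained _ _ (iter n P (P g) - iter n P g).
  by rewrite dn.
rewrite dn !mxE => dx.
(* A displacement of [d *+ n.+1] at [x] thus already contradicts [gn]. *)
have le_dn : d <= d *+ n.+1 by rewrite mulrS lerDl mulrn_wge0 // ltW.
have gx := ler_row_norm _ _ (iter n.+1 P g - g) x.
rewrite !mxE in gx.
have [s0|s0] := lerP 0 (iter n P (P g) ord0 x - iter n P g ord0 x).
- have : d *+ n.+1 <= iter n.+1 P g ord0 x - g ord0 x.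
    apply: (telescope_ge _ (fun k => iter k P g ord0 x)) => k kn.
    rewrite iterSr; apply: (max_component_pullback_iter _ _ _ _ n) => //.
    by rewrite -dx ger0_norm.
  have := ler_norm (iter n.+1 P g ord0 x - g ord0 x); lra.
(* For a negative component the entries are negated, and the pullback is applied with [g] and [P g]
   exchanged. *)
- have : d *+ n.+1 <= - iter n.+1 P g ord0 x - - g ord0 x.
    apply: (telescope_ge _ (fun k => - iter k P g ord0 x)) => k kn.
    rewrite opprK addrC iterSr.
    apply: (max_component_pullback_iter _ _ _ _ n) => //.
      by rewrite distrC.
    by rewrite -dx ltr0_norm // opprB.
  have := ler_norm (- (iter n.+1 P g ord0 x - g ord0 x)).
  rewrite normrN; lra.
Qed.

End Iteration.

Theorem theorem1 (R : realType) (N : nat) (f : 'rV[R]_N)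
    (P : 'rV[R]_N -> 'rV[R]_N)
    (P_mono : monotone_map P)
    (P_smono : strictly_monotone_components P)
    (P_nonexp : non_expansive P)
    (g : 'rV[R]_N)
    (g_acc : finite_accumulation_point (fun n : nat => iter n P f) g) :
  P g = g /\ iter n P f @[n --> \oo] --> g.
Proof.
have Pg : P g = g.
  apply: recurrent_fixed => // n e e_gt0.
  exact: accumulation_recurrent g_acc e_gt0.
split=> //; apply/cvgrPdist_lt => e e_gt0.
have [k [_ fk]] := g_acc 0%N e e_gt0.
near=> n; rewrite distrC.
have kn : (k <= n)%N by near: n; exact: nbhs_infty_ge.
(* As [g] is fixed, [P^(n-k)] carries the closeness at time [k] to time [n]. *)
apply: le_lt_trans fk; rewrite -(subnK kn) iterD.
have gE : iter (n - k) P g = g by rewrite iter_fix.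
by rewrite -{1}gE iter_nonexp.
Unshelve. all: by end_near.
Qed.
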